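(* $U_{4,7}$ is an excluded minor for the class of quasi-graphic matroids, i.e., $U_{4,7}$ is not quasi-graphic but every proper minor of $U_{4,7}$ is quasi-graphic.
   Context: Graphs may have loops and parallel edges. For a graph $H$ and vertex $v$, $\mathrm{loops}_H(v)$ denotes the set of loops of $H$ at $v$. A graph $H$ is a framework for a matroid $N$ if (QG1) $E(H)=E(N)$; (QG2) $r_N(E(H'))\le |V(H')|$ for each component $H'$ of $H$; (QG3) for each vertex $v$ of $H$, $\mathrm{cl}_N(E(H-v))\subseteq E(H-v)\cup \mathrm{loops}_H(v)$; (QG4) for each circuit $C$ of $N$, the subgraph $H[C]$ has at most two components. A matroid is quasi-graphic if it has a framework. *)

(* Defs.v *)
From mathcomp Require Import all_boot.
Set Implicit Arguments.
Unset Strict Implicit.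
Unset Printing Implicit Defensive.

(* A matroid has its ground set inside an ambient finite type [T], so that a
   matroid and its minors share the type [matroid T]. *)
Record matroid (T : finType) := Matroid {
  ground : {set T};
  indep : {set {set T}};
  indep_ground : forall I, I \in indep -> I \subset ground;
  indep0 : set0 \in indep;
  indep_sub : forall I J : {set T}, J \in indep -> I \subset J -> I \in indep;
  indep_aug : forall I J : {set T}, I \in indep -> J \in indep -> #|I| < #|J| ->
    exists2 e, e \in J :\: I & e |: I \in indep
}.

Section Matroids.
Variable T : finType.
Implicit Types (M N : matroid T) (A C D X : {set T}).

Definition rank M X : nat := \max_(I in indep M | I \subset X) #|I|.

Definition cl M X : {set T} :=
  [set e in ground M | rank M (e |: X) == rank M X].

Definition circuit M C : bool :=
  minset (fun X => (X \subset ground M) && (X \notin indep M)) C.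

(* Bases of the restriction [M | X]. *)
Definition basis_in M X (B : {set T}) : bool :=
  maxset (fun I => (I \subset X) && (I \in indep M)) B.

Section Deletion.
Variables (M : matroid T) (D : {set T}).

Definition delete_ground := ground M :\: D.
Definition delete_indep := [set I in indep M | I \subset delete_ground].

Fact delete_indep_ground I : I \in delete_indep -> I \subset delete_ground.
Proof. by rewrite inE => /andP[]. Qed.

Fact delete_indep0 : set0 \in delete_indep.
Proof. by rewrite inE indep0 sub0set. Qed.

Fact delete_indep_sub (I J : {set T}) :
  J \in delete_indep -> I \subset J -> I \in delete_indep.
Proof.
rewrite !inE => /andP[iJ sJ] sIJ.
by rewrite (indep_sub iJ sIJ) (subset_trans sIJ sJ).
Qed.

Fact delete_indep_aug (I J : {set T}) :
  I \in delete_indep -> J \in delete_indep -> #|I| < #|J| ->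
  exists2 e, e \in J :\: I & e |: I \in delete_indep.
Proof.
rewrite !inE => /andP[iI sI] /andP[iJ sJ] ltIJ.
have [e eJI ieI] := indep_aug iI iJ ltIJ; exists e => //.
rewrite inE ieI subUset sub1set sI andbT.
by apply: (subsetP sJ); move: eJI; rewrite inE => /andP[].
Qed.

Definition delete : matroid T :=
  Matroid delete_indep_ground delete_indep0 delete_indep_sub delete_indep_aug.
End Deletion.

Section Contraction.
Variables (M : matroid T) (C : {set T}).

Definition contract_ground := ground M :\: C.
Definition contract_indep := [set I : {set T} | (I \subset contract_ground) &&
  [exists B : {set T}, basis_in M C B && (I :|: B \in indep M)]].

Fact contract_indep_ground I : I \in contract_indep -> I \subset contract_ground.
Proof. by rewrite inE => /andP[]. Qed.

Fact contract_indep0 : set0 \in contract_indep.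
Proof.
rewrite inE sub0set /=.
have [|B mB _] := @maxset_exists _
  (fun I : {set T} => (I \subset C) && (I \in indep M)) set0.
  by rewrite sub0set indep0.
apply/existsP; exists B; rewrite /basis_in mB set0U.
by case/maxsetP: mB => /andP[].
Qed.

Fact contract_indep_sub (I J : {set T}) :
  J \in contract_indep -> I \subset J -> I \in contract_indep.
Proof.
rewrite !inE => /andP[sJ /existsP[B /andP[bB iJB]]] sIJ.
rewrite (subset_trans sIJ sJ); apply/existsP; exists B.
by rewrite bB (indep_sub iJB) // setSU.
Qed.

Fact basis_in_card (A B : {set T}) :
  basis_in M C A -> basis_in M C B -> #|B| <= #|A|.
Proof.
move=> /maxsetP[/andP[sA iA] maxA] /maxsetP[/andP[sB iB] _].
rewrite leqNgt; apply/negP => ltAB.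
have [e] := indep_aug iA iB ltAB; rewrite inE => /andP[eA eB] ieA.
have eqA : e |: A = A.
  by apply: maxA; rewrite ?subsetUr // subUset sub1set (subsetP sB) ?sA.
by case/negP: eA; rewrite -eqA setU11.
Qed.

Fact contract_indep_aug (I J : {set T}) :
  I \in contract_indep -> J \in contract_indep -> #|I| < #|J| ->
  exists2 e, e \in J :\: I & e |: I \in contract_indep.
Proof.
rewrite !inE => /andP[sI /existsP[A /andP[bA iIA]]].
move=> /andP[sJ /existsP[B /andP[bB iJB]]] ltIJ.
have /maxsetP[/andP[sA iA] maxA] := bA.
have /maxsetP[/andP[sB iB] _] := bB.
have cardC (K L : {set T}) : K \subset contract_ground -> L \subset C ->
    #|K :|: L| = #|K| + #|L|.
  move=> sK sL; rewrite cardsU; have -> : K :&: L = set0; last first.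
    by rewrite cards0 subn0.
  apply/setP => x; rewrite !inE; apply/negP => /andP[/(subsetP sK)].
  by rewrite inE => /andP[/negP xC _] /(subsetP sL).
have [|e] := indep_aug iIA iJB.
  by rewrite !cardC // -addSn leq_add // basis_in_card.
rewrite !inE negb_or => /andP[/andP[eI eA] eJB] ieIA.
have eC : e \notin C.
  apply: contra eA => eC; have <- : e |: A = A; last by rewrite setU11.
  apply: maxA; rewrite ?subsetUr // subUset sub1set eC sA.
  by apply: indep_sub ieIA _; rewrite setUS // subsetUr.
have eJ : e \in J.
  by case/orP: eJB => // /(subsetP sB); rewrite (negPf eC).
exists e; first by rewrite !inE eI eJ.
rewrite inE subUset sub1set (subsetP sJ) // sI /=.
by apply/existsP; exists A; rewrite bA -setUA.
Qed.

Definition contract : matroid T :=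
  Matroid contract_indep_ground contract_indep0
          contract_indep_sub contract_indep_aug.
End Contraction.

Definition minor N M : Prop := exists C D,
  [/\ C \subset ground M, D \subset ground M, [disjoint C & D]
    & N = delete (contract M C) D].

Definition proper_minor N M : Prop :=
  minor N M /\ ground N \proper ground M.

Definition excluded_minor (P : matroid T -> Prop) M : Prop :=
  ~ P M /\ (forall N, proper_minor N M -> P N).

End Matroids.

Section Uniform.
Variables r n : nat.

Definition uniform_indep := [set I : {set 'I_n} | #|I| <= r].

Fact uniform_indep_ground I : I \in uniform_indep -> I \subset [set: 'I_n].
Proof. by rewrite subsetT. Qed.

Fact uniform_indep0 : set0 \in uniform_indep.
Proof. by rewrite inE cards0. Qed.

Fact uniform_indep_sub (I J : {set 'I_n}) :
  J \in uniform_indep -> I \subset J -> I \in uniform_indep.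
Proof. by rewrite !inE => leJ /subset_leq_card/leq_trans->. Qed.

Fact uniform_indep_aug (I J : {set 'I_n}) :
  I \in uniform_indep -> J \in uniform_indep -> #|I| < #|J| ->
  exists2 e, e \in J :\: I & e |: I \in uniform_indep.
Proof.
rewrite !inE => _ leJ ltIJ.
have /subsetPn[e eJ eI] : ~~ (J \subset I).
  by apply: contraL ltIJ => /subset_leq_card; rewrite -leqNgt.
exists e; first by rewrite inE eI.
by rewrite inE cardsU1 eI (leq_trans ltIJ).
Qed.

Definition uniform : matroid 'I_n :=
  Matroid uniform_indep_ground uniform_indep0
          uniform_indep_sub uniform_indep_aug.
End Uniform.

(* Finite graphs with loops and parallel edges; vertices and edges are taken in
   ambient finite types [V] and [T].  [ends e] is the set of end-vertices of
   [e], so [e] is a loop exactly when it is a singleton. *)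
Record graph (V T : finType) := Graph {
  vset : {set V};
  eset : {set T};
  ends : T -> {set V};
  ends_sub : forall e, e \in eset -> ends e \subset vset;
  ends_card : forall e, e \in eset -> 0 < #|ends e| <= 2
}.

Section Graphs.
Variables V T : finType.
Implicit Types (H : graph V T) (K : {set V}) (C : {set T}) (v : V).

Section Subgraphs.
Variables (H : graph V T) (K : {set V}) (C : {set T}).

Definition induced_vset := vset H :&: K.
Definition induced_eset := [set e in eset H | ends H e \subset K].

Fact induced_ends_sub e : e \in induced_eset -> ends H e \subset induced_vset.
Proof. by rewrite inE subsetI => /andP[/ends_sub-> ->]. Qed.

Fact induced_ends_card e : e \in induced_eset -> 0 < #|ends H e| <= 2.
Proof. by rewrite inE => /andP[/ends_card]. Qed.

Definition induced : graph V T := Graph induced_ends_sub induced_ends_card.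

Definition edge_induced_eset := eset H :&: C.
Definition edge_induced_vset := \bigcup_(e in edge_induced_eset) ends H e.

Fact edge_induced_ends_sub e :
  e \in edge_induced_eset -> ends H e \subset edge_induced_vset.
Proof. by move=> eC; apply: bigcup_sup. Qed.

Fact edge_induced_ends_card e :
  e \in edge_induced_eset -> 0 < #|ends H e| <= 2.
Proof. by rewrite inE => /andP[/ends_card]. Qed.

(* [H[C]]: edges [C] and the vertices incident with them. *)
Definition edge_induced : graph V T :=
  Graph edge_induced_ends_sub edge_induced_ends_card.
End Subgraphs.

Definition delete_vertex H v : graph V T := induced H (vset H :\ v).

Definition loops H v : {set T} := [set e in eset H | ends H e == [set v]].

Definition adj H : rel V :=
  fun u v => [exists e in eset H, ends H e == [set u; v]].

(* Vertex sets of the components of [H]; the component with vertex set [K] is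
   [induced H K].  Isolated vertices are components. *)
Definition components H : {set {set V}} :=
  equivalence_partition (connect (adj H)) (vset H).

Record framework H (N : matroid T) : Prop := Framework {
  QG1 : eset H = ground N;
  QG2 : forall K, K \in components H ->
    rank N (eset (induced H K)) <= #|vset (induced H K)|;
  QG3 : forall v, v \in vset H ->
    cl N (eset (delete_vertex H v))
      \subset eset (delete_vertex H v) :|: loops H v;
  QG4 : forall C, circuit N C -> #|components (edge_induced H C)| <= 2
}.
End Graphs.

Definition quasi_graphic (T : finType) (N : matroid T) : Prop :=
  exists (V : finType) (H : graph V T), framework H N.

(* Main.v *)
Require Import Defs.
From mathcomp Require Import all_boot.
From mathcomp Require Import zify.

(** Let [H] be a framework for [U_{4,7}].  By (QG3) a vertex incident with a
    non-loop edge is avoided by at most 3 edges, hence meets at least 4 of them.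
    By (QG2) a component containing such a vertex has at least 4 vertices, and
    all of them are incident with non-loop edges, so there are at least 16
    incidences, whereas 7 edges provide at most 14.  Hence all the edges are
    loops, (QG2) allows at most one at each vertex, and a circuit induces 5
    components, against (QG4).

    The proper minors of [U_{4,7}] are the uniform matroids of rank at most [k]
    on at most 6 elements, with [k <= 4].  Subgraphs of [K_4] ([k = 4]), of the
    doubled triangle ([k = 3]), of a bundle of 6 parallel edges ([k = 2]) and of
    a bouquet of loops ([k <= 1]) are frameworks for them. *)

Set Implicit Arguments.
Unset Strict Implicit.
Unset Printing Implicit Defensive.

(** * Uniform matroids *)

Section UniformRank.
Variable T : finType.
Implicit Types (N : matroid T) (X : {set T}).

(* The rank of [N] is [k] only if [k <= #|ground N|]. *)
Definition is_uniform k N :=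
  forall I, (I \in indep N) = (I \subset ground N) && (#|I| <= k).

Lemma rank_uniform k N X :
  is_uniform k N -> X \subset ground N -> rank N X = minn k #|X|.
Proof.
move=> unifN sX; apply/eqP; rewrite eqn_leq; apply/andP; split.
  apply/bigmax_leqP => I; rewrite unifN => /andP[/andP[_ leI] sI].
  by rewrite leq_min leI subset_leq_card.
pose Y := [set x in take k (enum X)].
have sY : Y \subset X.
  by apply/subsetP => x; rewrite inE => /mem_take; rewrite mem_enum.
have cY : #|Y| = minn k #|X|.
  rewrite cardsE (card_uniqP _) ?take_uniq ?enum_uniq //.
  by rewrite size_take_min -cardE.
rewrite -cY; apply: (@leq_bigmax_cond _ _ (fun I : {set T} => #|I|)).
by rewrite unifN sY (subset_trans sY sX) cY geq_minl.
Qed.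

Lemma cl_uniform_small k N X :
  is_uniform k N -> X \subset ground N -> #|X| < k -> cl N X \subset X.
Proof.
move=> unifN sX ltX; apply/subsetP => e; rewrite inE => /andP[eN].
rewrite !(rank_uniform unifN) ?subUset ?sub1set ?eN // cardsU1.
by case: (e \in X) => //=; lia.
Qed.

Lemma cl_uniform_big k N X :
  is_uniform k N -> X \subset ground N -> k <= #|X| -> cl N X = ground N.
Proof.
move=> unifN sX leX; apply/setP => e; rewrite inE.
case eN: (e \in ground N) => //=.
rewrite !(rank_uniform unifN) ?subUset ?sub1set ?eN // cardsU1.
by apply/eqP; lia.
Qed.

End UniformRank.

Lemma uniform_is_uniform r n : is_uniform r (uniform r n).
Proof. by move=> I; rewrite inE subsetT. Qed.

(** A basis of the restriction to [C] has [minn k #|C|] elements and [I] avoids [C], so their union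
    is independent exactly when [#|I| + minn k #|C| <= k]. *)
Lemma minor_uniform T k (M : matroid T) (C D : {set T}) :
  is_uniform k M -> C \subset ground M ->
  is_uniform (k - #|C|) (delete (contract M C) D).
Proof.
move=> unifM sC I; rewrite !inE /= /contract_ground /delete_ground /=.
rewrite /contract_ground.
case sI: (I \subset ground M :\: C :\: D); last by rewrite andbF.
have {}sI : I \subset ground M :\: C by apply: subset_trans sI (subsetDl _ _).
rewrite sI andbT /=.
have basisC B : basis_in M C B -> B \subset C /\ #|B| = minn k #|C|.
  case/maxsetP => /andP[sB]; rewrite unifM => /andP[sBM leB] maxB.
  split=> //; apply/eqP; rewrite eqn_leq leq_min leB subset_leq_card //=.
  rewrite geq_min; apply/orP.
  have [ltB|?] := ltnP #|B| k; [right | by left].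
  apply/subset_leq_card/subsetP => e eC; apply: contraT => eB.
  have /setP/(_ e) : e |: B = B.
    apply: maxB; last exact: subsetUr.
    rewrite unifM !subUset !sub1set eC sB (subsetP sC) // sBM /=.
    by rewrite cardsU1 eB.
  by rewrite setU11 (negPf eB).
have cardU (B : {set T}) : B \subset C -> #|I :|: B| = #|I| + #|B|.
  move=> sB; rewrite cardsU; have -> : I :&: B = set0; last first.
    by rewrite cards0 subn0.
  apply/setP => x; rewrite !inE; apply/negP => /andP[/(subsetP sI)].
  by rewrite inE => /andP[/negP xC _] /(subsetP sB).
apply/existsP/idP => [[B /andP[/basisC[sB cB]]]|leI].
  by rewrite unifM => /andP[_]; rewrite cardU // cB; lia.
have [|B bB _] := @maxset_exists _
  (fun I : {set T} => (I \subset C) && (I \in indep M)) set0.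
  by rewrite sub0set indep0.
exists B; rewrite /basis_in bB unifM subUset /=.
have [sB cB] := basisC B bB.
rewrite (subset_trans sI (subsetDl _ _)) (subset_trans sB sC) cardU // cB.
(* [k - #|C|] is truncated: for [k < #|C|] only the empty set is independent. *)
lia.
Qed.

(** * Components *)

Section Components.
Variables V T : finType.
Implicit Types (H : graph V T) (K : {set V}).

Lemma adj_sym H : symmetric (adj H).
Proof.
by move=> u v; apply/existsP/existsP => -[e]; rewrite setUC => He; exists e.
Qed.

Lemma connect_adj_sym H : connect_sym (adj H).
Proof. exact/sym_connect_sym/adj_sym. Qed.

Lemma components_partition H : partition (components H) (vset H).
Proof.
apply: equivalence_partitionP => x y z _ _ _; split=> // xy.
exact/same_connect/xy/connect_adj_sym.
Qed.

Lemma mem_components H v : v \in vset H ->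
  [set u in vset H | connect (adj H) v u] \in components H.
Proof. by move=> vH; apply/imsetP; exists v. Qed.

Lemma ends_connect H e u v : e \in eset H ->
  u \in ends H e -> v \in ends H e -> connect (adj H) u v.
Proof.
move=> eH uE vE; have [->|neq] := eqVneq u v; first exact: connect0.
apply/connect1/existsP; exists e; rewrite eH /= eq_sym eqEcard.
by rewrite subUset !sub1set uE vE cards2 neq; case/andP: (ends_card eH).
Qed.

(** Each component contains the two distinct ends of some edge. *)
Lemma card_components_loopless H :
  {in eset H, forall e, #|ends H e| = 2} ->
  {in vset H, forall v, exists2 e, e \in eset H & v \in ends H e} ->
  2 * #|components H| <= #|vset H|.
Proof.
move=> loopless cov; rewrite (card_partition (components_partition H)).
rewrite mulnC -sum_nat_const; apply: leq_sum => K /imsetP[v vH ->].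
have [e eH ve] := cov v vH; rewrite -(loopless e eH).
apply/subset_leq_card/subsetP => u ue; rewrite inE.
by rewrite (subsetP (ends_sub eH)) // (ends_connect eH).
Qed.

Lemma card_components_le H : #|components H| <= #|vset H|.
Proof. exact: leq_imset_card. Qed.

End Components.

(** * Frameworks for the proper minors *)

Section UniformFrameworks.
Variable T : finType.
Implicit Types (N : matroid T).

(** Every element becomes a loop at the only vertex, so (QG3) holds because [loops] is the whole
    ground set. *)
Lemma uniform_le1_quasi_graphic k N :
  k <= 1 -> is_uniform k N -> quasi_graphic N.
Proof.
move=> le_k1 unifN; exists unit.
have sub e : e \in ground N -> [set: unit] \subset [set: unit] by [].
have crd e : e \in ground N -> 0 < #|[set: unit]| <= 2.
  by rewrite cardsT card_unit.
exists (Graph sub crd); split => //=.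
- move=> K Kc; rewrite (rank_uniform unifN); last first.
    by apply/subsetP => e; rewrite inE => /andP[].
  apply: leq_trans (leq_trans (geq_minl _ _) le_k1) _.
  rewrite /induced_vset setTI.
  have /and3P[_ _ K0] := components_partition (Graph sub crd).
  by rewrite card_gt0; apply: contraNneq K0 => <-.
- move=> v _; apply: subset_trans (subsetUr _ _).
  apply/subsetP => e; rewrite !inE => /andP[-> _] /=.
  by apply/eqP/setP => u; rewrite !inE; case: u; case: v.
- move=> C _; apply: leq_trans (card_components_le _) _.
  by apply: leq_trans (max_card _) _; rewrite card_unit.
Qed.

(* The edges of the graph are a prefix of the list [es] of vertex pairs. *)
Lemma uniform_quasi_graphic (V : finType) (p0 : V * V) (es : seq (V * V)) N :
  #|V| <= 4 -> is_uniform #|V| N -> #|ground N| <= size es ->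
  all (fun p => p.1 != p.2) es ->
  (forall K : {set V}, K != set0 -> K != setT ->
     count (fun p => (p.1 \in K) && (p.2 \in K)) es <= #|K|) ->
  1 < #|V| ->
  quasi_graphic N.
Proof.
move=> leV unifN le_es loopless sparse ltV.
pose s := enum (ground N).
(* The i-th element of the ground set receives the i-th pair; the default [p0] is not reached there,
   as [size s <= size es]. *)
pose pr e := nth p0 es (index e s).
pose en e := [set (pr e).1; (pr e).2].
have prE : map pr s = take (size s) es.
  have le_s : size s <= size es by rewrite -cardE.
  apply: (@eq_from_nth _ p0); first by rewrite size_map size_takel.
  rewrite size_map => i lti; have /hasP[e _ _] : has predT s.
    by rewrite has_predT (leq_ltn_trans _ lti).
  by rewrite (nth_map e) // nth_take // /pr index_uniq // enum_uniq.
have crd e : e \in ground N -> #|en e| = 2.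
  move=> eN; rewrite cards2 (allP loopless (pr e)) // mem_nth //.
  by apply: leq_trans le_es; rewrite cardE index_mem mem_enum.
have crd' e : e \in ground N -> 0 < #|en e| <= 2 by move=> /crd ->.
have sub e : e \in ground N -> en e \subset [set: V] by rewrite subsetT.
pose H := Graph sub crd'.
have card_ind K : K != set0 -> K != setT -> #|induced_eset H K| <= #|K|.
  move=> K0 KT; apply: leq_trans (sparse K K0 KT).
  rewrite -(cat_take_drop (size s) es) count_cat -prE count_map.
  apply: leq_trans (leq_addr _ _).
  rewrite -size_filter cardE; apply: uniq_leq_size; first exact: enum_uniq.
  move=> e; rewrite mem_enum mem_filter mem_enum inE /= => /andP[->].
  by rewrite /en subUset !sub1set => ->.
have sub_ind K : induced_eset H K \subset ground N.
  by apply/subsetP => e; rewrite inE => /andP[].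
exists V, H; split => //.
- move=> K Kc; rewrite (rank_uniform unifN) //= /induced_vset /= setTI.
  have [->|KT] := eqVneq K setT; first by rewrite cardsT geq_minl.
  apply: leq_trans (geq_minr _ _) _; apply: card_ind => //.
  have /and3P[_ _ Kn0] := components_partition H.
  by apply: contraNneq Kn0 => <-.
(* Sparsity of the complement of [v], nonempty as [1 < #|V|], leaves fewer than [#|V|] edges
   avoiding [v]; such a set is closed. *)
- move=> v _; apply: subset_trans (subsetUl _ _).
  have cardTv : #|[set: V] :\ v| = #|V|.-1.
    by rewrite -cardsT (cardsD1 v setT) in_setT.
  apply: (cl_uniform_small unifN) => //=.
  have -> : #|V| = #|[set: V] :\ v|.+1 by rewrite cardTv prednK // ltnW.
  apply: card_ind; first by rewrite -card_gt0 cardTv -subn1 subn_gt0.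
  by apply/eqP => /setP/(_ v); rewrite !inE eqxx.
(* Without loops or isolated vertices, at most 4 vertices form at most 2 components. *)
- move=> C _; rewrite -(@leq_pmul2l 2) //.
  apply: leq_trans (card_components_loopless _ _) _ => /=.
  + by move=> e; rewrite inE => /andP[/crd].
  + by move=> v /bigcupP[e eC ve]; exists e.
  + exact: leq_trans (max_card _) leV.
Qed.

Lemma uniform2_quasi_graphic N :
  is_uniform 2 N -> #|ground N| <= 6 -> quasi_graphic N.
Proof.
move=> unifN leN; pose a : 'I_2 := ord0; pose b : 'I_2 := lift ord0 ord0.
apply: (@uniform_quasi_graphic _ (a, a) (nseq 6 (a, b)));
  rewrite ?card_ord // => K _ KT.
(* Sparsity is checked by cases on which vertices lie in [K]; [KT] rules out the full vertex set,
   where the six pairs outnumber the vertices. *)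
have cardK : #|K| = (a \in K) + (b \in K).
  by rewrite -sum1_card big_mkcond !big_ord_recl big_ord0; do 2!case: (_ \in K).
move: KT; rewrite eqEcard subsetT cardsT card_ord cardK /=.
by do 2!case: (_ \in K).
Qed.

Lemma uniform3_quasi_graphic N :
  is_uniform 3 N -> #|ground N| <= 6 -> quasi_graphic N.
Proof.
move=> unifN leN; pose a : 'I_3 := ord0; pose b : 'I_3 := lift ord0 ord0.
pose c : 'I_3 := lift ord0 (lift ord0 ord0).
apply: (@uniform_quasi_graphic _ (a, a)
  [:: (a, b); (a, b); (a, c); (a, c); (b, c); (b, c)]);
  rewrite ?card_ord // => K _ KT.
have cardK : #|K| = (a \in K) + (b \in K) + (c \in K).
  by rewrite -sum1_card big_mkcond !big_ord_recl big_ord0; do 3!case: (_ \in K).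
move: KT; rewrite eqEcard subsetT cardsT card_ord cardK /=.
by do 3!case: (_ \in K).
Qed.

Lemma uniform4_quasi_graphic N :
  is_uniform 4 N -> #|ground N| <= 6 -> quasi_graphic N.
Proof.
move=> unifN leN; pose a : 'I_4 := ord0; pose b : 'I_4 := lift ord0 ord0.
pose c : 'I_4 := lift ord0 (lift ord0 ord0).
pose d : 'I_4 := lift ord0 (lift ord0 (lift ord0 ord0)).
apply: (@uniform_quasi_graphic _ (a, a)
  [:: (a, b); (a, c); (a, d); (b, c); (b, d); (c, d)]);
  rewrite ?card_ord // => K _ KT.
have cardK : #|K| = (a \in K) + (b \in K) + (c \in K) + (d \in K).
  by rewrite -sum1_card big_mkcond !big_ord_recl big_ord0; do 4!case: (_ \in K).
move: KT; rewrite eqEcard subsetT cardsT card_ord cardK /=.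
by do 4!case: (_ \in K).
Qed.

End UniformFrameworks.

(** * No framework for [U_{4,7}] *)

Section NoFramework.
Variables (V : finType) (H : graph V 'I_7).
Hypothesis frH : framework H (uniform 4 7).

Let esetT e : e \in eset H.
Proof. by rewrite (QG1 frH) inE. Qed.

Let rankE X : rank (uniform 4 7) X = minn 4 #|X|.
Proof. exact: (rank_uniform (@uniform_is_uniform 4 7) (subsetT X)). Qed.

Definition nonloop_vertex v :=
  [exists e, (v \in ends H e) && (#|ends H e| == 2)].

Lemma nonloop_vertex_vset v : nonloop_vertex v -> v \in vset H.
Proof. by case/existsP=> e /andP[/(subsetP (ends_sub (esetT e)))]. Qed.

(** Four edges avoiding [v] would span the matroid, and their closure would contain a non-loop edge
    at [v]. *)
Lemma nonloop_vertex_degree v :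
  nonloop_vertex v -> 4 <= #|[set e | v \in ends H e]|.
Proof.
move=> Wv; have vH := nonloop_vertex_vset Wv.
set X := eset (delete_vertex H v).
have XE : X = ~: [set e | v \in ends H e].
  apply/setP => e; rewrite /X /= !inE esetT /= subsetD1.
  by rewrite (ends_sub (esetT e)).
have [leX|ltX] := leqP 4 #|X|; last first.
  by have := cardsC [set e | v \in ends H e]; rewrite -XE card_ord; lia.
have /existsP[e /andP[ve /eqP e2]] := Wv.
have := QG3 frH vH; rewrite -/X.
rewrite (cl_uniform_big (@uniform_is_uniform 4 7)) ?subsetT //.
move/subsetP/(_ e (in_setT e)); rewrite in_setU XE !inE ve /=.
by case/andP=> _ /eqP ev; move: e2; rewrite ev cards1.
Qed.

(** Double counting of incidences: at least 4 per vertex of [W], at most 2 per edge, and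
    [4 * 4 > 7 * 2]. *)
Lemma card_nonloop_vertices : #|[set v | nonloop_vertex v]| <= 3.
Proof.
set W := [set v | _].
have : \sum_(v in W) 4 <= \sum_(v in W) \sum_(e | v \in ends H e) 1.
  apply: leq_sum => v; rewrite inE => /nonloop_vertex_degree.
  by rewrite sum1_card cardsE.
rewrite (exchange_big_dep predT) //= sum_nat_const => leW.
suff : #|W| * 4 <= \sum_(e : 'I_7) 2 by rewrite sum_nat_const card_ord; lia.
apply: leq_trans leW _; apply: leq_sum => e _; rewrite sum1_card.
case/andP: (ends_card (esetT e)) => _; apply: leq_trans.
by apply/subset_leq_card/subsetP => v /andP[].
Qed.

(** [adj] also holds along loops, but the first edge of a duplicate-free path from [u] to [v] leaves
    [u]. *)
Lemma connect_nonloop_vertex u v :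
  u != v -> connect (adj H) u v -> nonloop_vertex u.
Proof.
move=> neq /connectP[p pth lst]; move: pth lst.
case/shortenP => -[|x q] /=; first by move=> _ _ _ e; rewrite e eqxx in neq.
case/andP=> /existsP[e /andP[_ /eqP ee]] _ /andP[].
rewrite inE negb_or => /andP[ux _] _ _ _.
by apply/existsP; exists e; rewrite ee !inE eqxx cards2 ux.
Qed.

Lemma no_nonloop_vertex v : ~~ nonloop_vertex v.
Proof.
apply/negP => Wv; have vH := nonloop_vertex_vset Wv.
have := QG2 frH (mem_components vH); rewrite rankE /=.
set K := [set u in vset H | _]; rewrite /induced_vset => leK.
have le4 : 4 <= #|induced_eset H K|.
  apply: leq_trans (nonloop_vertex_degree Wv) _.
  apply/subset_leq_card/subsetP => e; rewrite !inE esetT => ve /=.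
  apply/subsetP => u ue; rewrite inE (subsetP (ends_sub (esetT e))) //=.
  exact: ends_connect ve ue.
(* Every vertex of the component is [v] or connected to [v], hence lies on a non-loop edge. *)
have leKW : #|vset H :&: K| <= #|[set v | nonloop_vertex v]|.
  apply/subset_leq_card/subsetP => u; rewrite !inE => /and3P[_ _ vu].
  have [->//|neq] := eqVneq u v.
  by apply: connect_nonloop_vertex neq _; rewrite connect_adj_sym.
have := leq_trans leK (leq_trans leKW card_nonloop_vertices).
by rewrite (minn_idPl le4).
Qed.

Lemma ends_loop e : exists v, ends H e = [set v].
Proof.
apply/cards1P.
have /andP[e0 e2] := ends_card (esetT e).
have [v ve] : exists v, v \in ends H e by apply/set0Pn; rewrite -card_gt0.
have := no_nonloop_vertex v; rewrite negb_exists => /forallP/(_ e).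
by rewrite ve /=; move: e0 e2; case: #|_| => [|[|[]]].
Qed.

(** All edges being loops, components are single vertices. The graph [G] is either [H] or
    [edge_induced H C]. *)
Lemma loop_class (G : graph V 'I_7) v :
  subrel (adj G) (adj H) -> v \in vset G ->
  [set u in vset G | connect (adj G) v u] = [set v].
Proof.
move=> sGH vG; apply/setP => u; rewrite !inE.
apply/andP/eqP => [[_ vu]|->]; last by [].
apply/eqP; apply: contraT; rewrite eq_sym => neq.
case/negP: (no_nonloop_vertex v); apply: connect_nonloop_vertex neq _.
by apply: connect_sub vu => x y /sGH/connect1.
Qed.

(** Two loops at one vertex would have rank 2 inside a one-vertex component, against (QG2). *)
Lemma ends_injective : injective (ends H).
Proof.
move=> e f eq_ef; apply/eqP; apply: contraT => neq.
have [v ev] := ends_loop e.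
have vH : v \in vset H.
  by rewrite (subsetP (ends_sub (esetT e))) // ev set11.
have := QG2 frH (mem_components vH); rewrite rankE /=.
set K := [set u in vset H | _].
have KE : K = [set v] by apply: loop_class.
rewrite /induced_vset KE => leK.
have le2 : #|[set e; f]| <= #|induced_eset H [set v]|.
  apply/subset_leq_card/subsetP => g.
  by rewrite !inE esetT => /orP[]/eqP->; rewrite -?eq_ef ev subxx.
have le1 : #|vset H :&: [set v]| <= 1.
  by rewrite (leq_trans (subset_leq_card (subsetIr _ _))) ?cards1.
have := leq_trans leK le1; rewrite geq_min /= => /(leq_trans le2).
by rewrite cards2 neq.
Qed.

Lemma framework_absurd : False.
Proof.
(* The circuits of [uniform 4 7] are the 5-element sets; any of them would do. *)
pose C := [set e : 'I_7 | e < 5].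
have cardC : #|C| = 5.
  by rewrite -sum1_card big_mkcond !big_ord_recl big_ord0 !inE.
have circC : circuit (uniform 4 7) C.
  apply/minsetP; split; first by rewrite !inE subsetT cardC.
  move=> X; rewrite !inE subsetT -ltnNge /= => ltX sX.
  by apply/eqP; rewrite eqEcard sX cardC.
(* Each edge of [C] is a loop whose vertex alone is a component, and distinct edges have distinct
   vertices. *)
have : ends H @: C \subset components (edge_induced H C).
  apply/subsetP => _ /imsetP[e eC ->]; have [v ev] := ends_loop e.
  have vC : v \in vset (edge_induced H C).
    by apply/bigcupP; exists e; rewrite ?ev ?set11 // inE esetT.
  rewrite ev -(loop_class _ vC) ?mem_components // => x y.
  by case/existsP=> f /andP[_ fxy]; apply/existsP; exists f; rewrite esetT.
move/subset_leq_card; rewrite card_imset; last exact: ends_injective.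
by move/leq_trans/(_ (QG4 frH circC)); rewrite cardC.
Qed.

End NoFramework.

Theorem theorem3p2 : excluded_minor (@quasi_graphic 'I_7) (uniform 4 7).
Proof.
split=> [[V [H frH]]|N [[C [D [sC sD _ defN]]] ltN]].
  exact: framework_absurd frH.
have {ltN} leN : #|ground N| <= 6.
  by have := proper_card ltN; rewrite cardsT card_ord.
have unifN : is_uniform (4 - #|C|) N.
  by rewrite defN; apply: minor_uniform => //; apply: uniform_is_uniform.
have : 4 - #|C| <= 4 by apply: leq_subr.
(* Only the bound [4 - #|C|], one of 0 to 4, and the size of the ground set matter from here on. *)
move: (4 - #|C|) unifN => [|[|[|[|[|k]]]]] // unifN _.
- exact: uniform_le1_quasi_graphic unifN.
- exact: uniform_le1_quasi_graphic unifN.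
- exact: uniform2_quasi_graphic.
- exact: uniform3_quasi_graphic.
- exact: uniform4_quasi_graphic.
Qed.
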